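(* Let $f_1 = f_1^+ x + f_1^- y \in \mathcal{B}_1$, with $f_1^{+}, f_1^{-} \in \mathbf{J}$. The following assertions are equivalent: (i) $f_1$ is a right zero divisor in $\mathcal{B}$; (ii) $f_1$ is a left zero divisor in $\mathcal{B}$; (iii) $f_1$ is nilpotent; (iv) $f_1^2 = 0$; (v) $f_1^- = 0$ or $f_1^- y^2 = - f_1^+ z$.
   Context: Let $\Bbbk$ be a (commutative) field of characteristic $p \neq 2$ ($p=0$ is allowed). The super Jordan plane $\mathcal{B}$ is the associative unital $\Bbbk$-algebra presented by generators $x, y$ with defining relations $x^2 = 0$ and $yz - zy - xz = 0$, where $z = xy + yx$. The relations are homogeneous for $\deg x = \deg y = 1$, so $\mathcal{B}$ is $\mathbb{Z}$-graded, and it is a superalgebra ($\mathbb{Z}/2\mathbb{Z}$-graded algebra) $\mathcal{B} = \mathcal{B}_0 \oplus \mathcal{B}_1$, where $\mathcal{B}_0$ (respectively $\mathcal{B}_1$) is the sum of the components of even (respectively odd) degree. $\mathbf{J}$ denotes the subalgebra of $\mathcal{B}$ generated by $z$ and $y^2$ (it is a copy of the Jordan plane, a domain, with relation $y^2 z - z y^2 = z^2$). One has $\mathcal{B}_1 = \mathbf{J}x \oplus \mathbf{J}y$, and $x$ and $y$ are left $\mathbf{J}$-linearly independent, so each $f_1 \in \mathcal{B}_1$ is uniquely of the form $f_1^+x + f_1^-y$ with $f_1^{\pm}\in\mathbf{J}$. Convention on zero divisors in a ring $R$: $f$ is called a right zero divisor if there is $g \in R$, $g \neq 0$, with $fg =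 0$, and a left zero divisor if there is $g \in R$, $g\neq 0$, with $gf = 0$. In particular $0$ counts as a zero divisor. *)

(* Defs.v *)
From HB Require Import structures.
From mathcomp Require Import all_boot all_algebra.
From mathcomp Require Import boolp finmap.
From mathcomp.multinomials Require Import monalg.

Set Implicit Arguments.
Unset Strict Implicit.
Unset Printing Implicit Defensive.

Import GRing.Theory.
Import Quotient.

Local Open Scope ring_scope.
Local Open Scope quotient_scope.

Inductive ideal_gen {A : nzRingType} (S : A -> Prop) : A -> Prop :=
| ideal_gen_sub a : S a -> ideal_gen S a
| ideal_gen0 : ideal_gen S 0
| ideal_genD a b : ideal_gen S a -> ideal_gen S b -> ideal_gen S (a + b)
| ideal_genMl c a : ideal_gen S a -> ideal_gen S (c * a)
| ideal_genMr c a : ideal_gen S a -> ideal_gen S (a * c).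

Inductive subalg_gen {k : nzRingType} {A : lalgType k} (S : A -> Prop) : A -> Prop :=
| subalg_gen_sub a : S a -> subalg_gen S a
| subalg_gen1 : subalg_gen S 1
| subalg_genD a b : subalg_gen S a -> subalg_gen S b -> subalg_gen S (a + b)
| subalg_genM a b : subalg_gen S a -> subalg_gen S b -> subalg_gen S (a * b)
| subalg_genZ (c : k) a : subalg_gen S a -> subalg_gen S (c *: a).

Definition right_zero_divisor {A : nzRingType} (f : A) : Prop :=
  exists2 g : A, g != 0 & f * g = 0.

Definition left_zero_divisor {A : nzRingType} (f : A) : Prop :=
  exists2 g : A, g != 0 & g * f = 0.

Definition nilpotent_elt {A : nzRingType} (f : A) : Prop :=
  exists n : nat, f ^+ n = 0.

(* The free associative algebra on two generators: the monoid algebra of the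
   free monoid of words in the letters 0 and 1. *)
Notation free_alg k := {malg k[{fmonom 'I_2}]}.

Section SuperJordanIdeal.
Variable k : fieldType.

Definition freeX : free_alg k := << fmu (0 : 'I_2) >>.
Definition freeY : free_alg k := << fmu (1 : 'I_2) >>.
Definition freeZ : free_alg k := freeX * freeY + freeY * freeX.

Definition sjp_rel (a : free_alg k) : Prop :=
  a = freeX ^+ 2 \/ a = freeY * freeZ - freeZ * freeY - freeX * freeZ.

Definition sjp_ideal : pred (free_alg k) := fun a => `[< ideal_gen sjp_rel a >].

Lemma sjp_idealP a : reflect (ideal_gen sjp_rel a) (a \in sjp_ideal).
Proof. exact: asboolP. Qed.

Lemma sjp_ideal_zmod_closed : zmod_closed sjp_ideal.
Proof.
split=> [|a b /sjp_idealP Ia /sjp_idealP Ib]; apply/sjp_idealP.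
  exact: ideal_gen0.
by apply: ideal_genD => //; rewrite -mulN1r; apply: ideal_genMl.
Qed.

HB.instance Definition _ :=
  GRing.isZmodClosed.Build (free_alg k) sjp_ideal sjp_ideal_zmod_closed.

Definition sjp_ideal_zmod : zmodClosed (free_alg k) :=
  GRing.ZmodClosed.clone _ sjp_ideal _.

Lemma sjp_idealMl c a : a \in sjp_ideal -> c * a \in sjp_ideal.
Proof. by move=> /sjp_idealP Ia; apply/sjp_idealP/ideal_genMl. Qed.

Lemma sjp_idealMr c a : a \in sjp_ideal -> a * c \in sjp_ideal.
Proof. by move=> /sjp_idealP Ia; apply/sjp_idealP/ideal_genMr. Qed.

Lemma rmorph_sjp_relE (A B : nzRingType) (e : {rmorphism A -> B}) x y :
    let z := x * y + y * x in let ez := e x * e y + e y * e x in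
  e (y * z - z * y - x * z) = e y * ez - ez * e y - e x * ez.
Proof. by rewrite /= !rmorphB !rmorphM !rmorphD !rmorphM. Qed.

(* Elements of the ideal have no constant term, hence the quotient is not
   trivial. *)
Lemma sjp_ideal_coef1 (a : free_alg k) : a \in sjp_ideal -> a@_mone = 0.
Proof.
pose e := (@mcoeff _ _ mone : {rmorphism free_alg k -> k}).
have eM a' b' : e (a' * b') = e a' * e b' by apply: rmorphM.
have eU i : e << fmu i >> = 0.
  by rewrite /e /= mcoeffU1 -fdeg_eq0 fdegU.
move=> /sjp_idealP; rewrite -[_@__]/(e a).
elim=> {a} [a [] -> | | a b _ ea _ eb | c a _ ea | c a _ ea].
- by apply: etrans (eM _ _) _; rewrite [X in X * _]eU mul0r.
- have eX : e freeX = 0 := eU _; have eY : e freeY = 0 := eU _.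
  by apply: etrans (rmorph_sjp_relE e freeX freeY) _;
    rewrite [X in X * _ - _ * X]eY [X in _ - X * _]eX !(mul0r, mulr0) !subr0.
- exact: rmorph0.
- by apply: etrans (rmorphD e _ _) _; rewrite ea eb addr0.
- by apply: etrans (eM _ _) _; rewrite ea mulr0.
- by apply: etrans (eM _ _) _; rewrite ea mul0r.
Qed.

Lemma free_alg_scaleAr (c : k) (a b : free_alg k) :
  c *: (a * b) = a * (c *: b).
Proof.
apply/malgP => m; transitivity (c * (a * b)@_m); first exact: mcoeffZ.
rewrite [RHS](mcoeffMlw m (fsubset_refl _) (msuppZ_le c b)).
rewrite [X in _ * X = _](mcoeffMl a b m) mulr_sumr.
apply: eq_bigr => m1 _; rewrite mulr_sumr; apply: eq_bigr => m2 _.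
by rewrite (mcoeffZ c b m2) mulrnAr mulrCA.
Qed.

(* ring_quotient only makes a ring of {quot I} for commutative rings, so the
   ring and algebra structures are built below. *)
Definition sjp : Type := {quot sjp_ideal_zmod}.
HB.instance Definition _ := GRing.Zmodule.on sjp.

Definition sjp_pi (a : free_alg k) : sjp := \pi_({quot sjp_ideal_zmod}) a.
Definition sjp_repr (u : sjp) : free_alg k := repr (u : {quot sjp_ideal_zmod}).

Lemma sjp_reprK : cancel sjp_repr sjp_pi.
Proof. exact: reprK. Qed.

Lemma sjp_piP (a b : free_alg k) : sjp_pi a = sjp_pi b <-> a - b \in sjp_ideal.
Proof. by rewrite idealrBE; split=> /eqP. Qed.

Lemma sjp_pi_zmod : zmod_morphism sjp_pi.
Proof. by move=> a b; rewrite /sjp_pi raddfB. Qed.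
HB.instance Definition _ :=
  GRing.isZmodMorphism.Build (free_alg k) sjp sjp_pi sjp_pi_zmod.

End SuperJordanIdeal.

(* The operations and generators are locked, since failing conversion tests
   between elements of free_alg k are very slow. *)
HB.lock Definition sjp_mul (k : fieldType) (u v : sjp k) : sjp k :=
  sjp_pi (sjp_repr u * sjp_repr v).
HB.lock Definition sjp_scale (k : fieldType) (c : k) (u : sjp k) : sjp k :=
  sjp_pi (c *: sjp_repr u).
HB.lock Definition sjpX (k : fieldType) : sjp k := sjp_pi (freeX k).
HB.lock Definition sjpY (k : fieldType) : sjp k := sjp_pi (freeY k).
Arguments sjpX {k}.
Arguments sjpY {k}.

Section SuperJordanPlane.
Variable k : fieldType.
Implicit Types (c d : k) (u v w : sjp k) (a b : free_alg k).

Lemma sjp_mulE a b : sjp_mul (sjp_pi a) (sjp_pi b) = sjp_pi (a * b).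
Proof.
rewrite sjp_mul.unlock; apply/sjp_piP; set a' := sjp_repr _; set b' := sjp_repr _.
have Ia : a' - a \in @sjp_ideal k by apply/sjp_piP; rewrite sjp_reprK.
have Ib : b' - b \in @sjp_ideal k by apply/sjp_piP; rewrite sjp_reprK.
have -> : a' * b' - a * b = a' * (b' - b) + (a' - a) * b.
  by rewrite mulrBr mulrBl addrA subrK.
apply: (@rpredD _ (sjp_ideal_zmod k)); first exact: sjp_idealMl.
exact: sjp_idealMr.
Qed.

Lemma sjp_scaleE c a : sjp_scale c (sjp_pi a) = sjp_pi (c *: a).
Proof.
rewrite sjp_scale.unlock; apply/sjp_piP.
rewrite -scalerBr -mul_malgC sjp_idealMl //.
by apply/sjp_piP; rewrite sjp_reprK.
Qed.

Lemma sjp_mulA : associative (@sjp_mul k).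
Proof.
move=> u v w; rewrite -[u]sjp_reprK -[v]sjp_reprK -[w]sjp_reprK.
by rewrite !sjp_mulE mulrA.
Qed.

Lemma sjp_mul1 : left_id (sjp_pi 1) (@sjp_mul k).
Proof. by move=> u; rewrite -[u]sjp_reprK sjp_mulE mul1r. Qed.

Lemma sjp_mulr1 : right_id (sjp_pi 1) (@sjp_mul k).
Proof. by move=> u; rewrite -[u]sjp_reprK sjp_mulE mulr1. Qed.

Lemma sjp_mulDl : left_distributive (@sjp_mul k) +%R.
Proof.
move=> u v w; rewrite -[u]sjp_reprK -[v]sjp_reprK -[w]sjp_reprK.
by rewrite -raddfD !sjp_mulE -raddfD mulrDl.
Qed.

Lemma sjp_mulDr : right_distributive (@sjp_mul k) +%R.
Proof.
move=> u v w; rewrite -[u]sjp_reprK -[v]sjp_reprK -[w]sjp_reprK.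
by rewrite -raddfD !sjp_mulE -raddfD mulrDr.
Qed.

Lemma sjp_one_neq0 : sjp_pi 1 != 0 :> sjp k.
Proof.
apply/eqP; rewrite -(raddf0 (@sjp_pi k)) => /sjp_piP; rewrite subr0.
move=> /sjp_ideal_coef1 /eqP; rewrite mcoeff1 eqxx; apply/negP.
exact: oner_neq0.
Qed.

HB.instance Definition _ := GRing.Zmodule_isNzRing.Build (sjp k)
  sjp_mulA sjp_mul1 sjp_mulr1 sjp_mulDl sjp_mulDr sjp_one_neq0.

Lemma sjp_pi_monoid : monoid_morphism (@sjp_pi k).
Proof. by split=> // a b; rewrite -sjp_mulE. Qed.
HB.instance Definition _ :=
  GRing.isMonoidMorphism.Build (free_alg k) (sjp k) (@sjp_pi k) sjp_pi_monoid.

Lemma sjp_scaleA c d u : sjp_scale c (sjp_scale d u) = sjp_scale (c * d) u.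
Proof. by rewrite -[u]sjp_reprK !sjp_scaleE scalerA. Qed.

Lemma sjp_scale1 : left_id 1 (@sjp_scale k).
Proof. by move=> u; rewrite -[u]sjp_reprK sjp_scaleE scale1r. Qed.

Lemma sjp_scaleDr : right_distributive (@sjp_scale k) +%R.
Proof.
move=> c u v; rewrite -[u]sjp_reprK -[v]sjp_reprK.
by rewrite -raddfD !sjp_scaleE -raddfD scalerDr.
Qed.

Lemma sjp_scaleDl u : {morph (@sjp_scale k)^~ u : c d / c + d}.
Proof. by move=> c d; rewrite -[u]sjp_reprK !sjp_scaleE -raddfD scalerDl. Qed.

HB.instance Definition _ := GRing.Zmodule_isLmodule.Build k (sjp k)
  sjp_scaleA sjp_scale1 sjp_scaleDr sjp_scaleDl.

Lemma sjp_pi_scalable : scalable (@sjp_pi k).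
Proof. by move=> c a; rewrite -sjp_scaleE. Qed.
HB.instance Definition _ :=
  GRing.isScalable.Build k (free_alg k) (sjp k) *:%R (@sjp_pi k) sjp_pi_scalable.

Lemma sjp_scaleAl c u v : c *: (u * v) = c *: u * v.
Proof.
rewrite -[u]sjp_reprK -[v]sjp_reprK -rmorphM -!linearZ /= -rmorphM.
by rewrite scalerAl.
Qed.

HB.instance Definition _ := GRing.Lmodule_isLalgebra.Build k (sjp k) sjp_scaleAl.

Lemma sjp_scaleAr c u v : c *: (u * v) = u * (c *: v).
Proof.
rewrite -[u]sjp_reprK -[v]sjp_reprK -rmorphM -!linearZ /= -rmorphM.
by rewrite free_alg_scaleAr.
Qed.

HB.instance Definition _ := GRing.Lalgebra_isAlgebra.Build k (sjp k) sjp_scaleAr.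

Definition sjpZ : sjp k := sjpX * sjpY + sjpY * sjpX.

Lemma sjp_pi_rel a : sjp_rel a -> sjp_pi a = 0.
Proof.
move=> Sa; transitivity (sjp_pi (0 : free_alg k)); last exact: raddf0.
by apply/sjp_piP; rewrite subr0; apply/sjp_idealP/ideal_gen_sub.
Qed.

Lemma sjpX2 : sjpX ^+ 2 = 0 :> sjp k.
Proof.
rewrite sjpX.unlock -[LHS](rmorphXn (@sjp_pi k) 2 (freeX k)).
by apply: sjp_pi_rel; left.
Qed.

Lemma sjpYZ : sjpY * sjpZ - sjpZ * sjpY - sjpX * sjpZ = 0.
Proof.
rewrite /sjpZ sjpX.unlock sjpY.unlock.
apply: etrans (esym (rmorph_sjp_relE (@sjp_pi k) (freeX k) (freeY k))) _.
by apply: sjp_pi_rel; right.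
Qed.

(* The component of degree n: the image of the span of the words of length n. *)
Definition sjp_homog (n : nat) (f : sjp k) : Prop :=
  exists2 a : free_alg k,
    (forall m, m \in msupp a -> fdeg m = n) & f = sjp_pi a.

(* The sum of the components of odd degree. *)
Definition sjp_odd (f : sjp k) : Prop :=
  exists N : nat, exists2 c : nat -> sjp k,
    (forall n, sjp_homog n (c n)) & f = \sum_(n < N | odd n) c n.

Definition jordan_plane : sjp k -> Prop :=
  subalg_gen (fun f => f = sjpZ \/ f = sjpY ^+ 2).

End SuperJordanPlane.

Arguments sjpZ {k}.

(* Main.v *)
Require Import Defs.
From HB Require Import structures.
From mathcomp Require Import all_boot all_algebra finmap.
From mathcomp.multinomials Require Import monalg.

(** The super Jordan plane embeds into the 2 x 2 matrices over a domain, in such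
    a way that odd elements become antidiagonal matrices; for an antidiagonal
    matrix with entries P and Q over a domain, being a zero divisor on either
    side, being nilpotent and having square zero all mean that P = 0 or Q = 0.

    The domain is the skew polynomial ring K = k[W][Z] with W Z = Z (W + 1),
    and the representation phi is
      x |-> (0 1; 0 0),   y |-> (0 W; Z 0),
    so that z = x y + y x |-> diag(Z, Z) and t = y^2 |-> diag(W Z, Z W). It is
    found by looking for matrix units: z^-1 x y would be an idempotent commuting
    with the Jordan plane J, so that after inverting z the algebra becomes a
    matrix algebra in which x can be normalised to the matrix unit E_12.

    An element a of J is sent to diag(p, p') with p' Z = Z p
    (matrix_rep_jordan). Hence f1 = f+ x + f- y is sent to the antidiagonal
    matrix with entries P = p(f+) + p(f-) W and Q = Z p(f-). Moreover
    P Z = p(f+ z + f- t), so once a |-> p(a) is known to be injective on J, the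
    equation Q = 0 says f- = 0 and P = 0 says f- t = - f+ z
    (matrix_rep_odd): this is the last assertion of the theorem.

    Faithfulness has two ingredients. First, the relations suffice to write
    every element as u + p x + q y + r x y with u, p, q, r in J
    (normal_formP), and the four entries of its image determine the images of
    u, p, q, r (matrix_rep_inj). Second, every element of J is a sum of terms
    g_j(z) t^j (subalg_gen_jordan_form), whose image has upper left entry
    the sum of the g_j(Z) Z^j (W + 1) ... (W + j); the last factor has degree j
    in W, so the g_j can be read off (jordan_rep_inj). *)

Set Implicit Arguments.
Unset Strict Implicit.
Unset Printing Implicit Defensive.

Import GRing.Theory.
Local Open Scope ring_scope.

(** * Skew polynomial rings *)

(** The ring of polynomials in an indeterminate Z with coefficients written on
    the right, subject to c Z = Z s(c) for every coefficient c. *)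
Definition skew_poly (R : nzRingType) (s : {rmorphism R -> R}) : Type :=
  {poly R}.

Section SkewPolynomials.
Variables (R : nzRingType) (s : {rmorphism R -> R}).
HB.instance Definition _ := GRing.Zmodule.on (skew_poly s).
Implicit Types p q r : {poly R}.

Definition skew_twist (n : nat) : {poly R} -> {poly R} := iter n (map_poly s).

(** Since Z^i commutes with the indeterminate, p Z^i c is computed with the
    ordinary product once s has been applied i times to p. *)
Definition skew_mul p q :=
  \sum_(i < size q) skew_twist i p * 'X^i * (q`_i)%:P.

Lemma skew_twist_zmod n : zmod_morphism (skew_twist n).
Proof.
by rewrite /skew_twist; elim: n => // n IHn p q; rewrite !iterS IHn rmorphB.
Qed.

Lemma skew_twist_monoid n : monoid_morphism (skew_twist n).
Proof.
rewrite /skew_twist; elim: n => // n [IH1 IHM].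
by split=> [|p q]; rewrite !iterS ?IH1 ?IHM ?rmorph1 ?rmorphM.
Qed.

HB.instance Definition _ n :=
  GRing.isZmodMorphism.Build _ _ (skew_twist n) (skew_twist_zmod n).
HB.instance Definition _ n :=
  GRing.isMonoidMorphism.Build _ _ (skew_twist n) (skew_twist_monoid n).

Lemma skew_twistXn n m : skew_twist n 'X^m = 'X^m.
Proof.
by rewrite /skew_twist; elim: n => // n IHn; rewrite iterS IHn map_polyXn.
Qed.

Lemma skew_twist_twist m n p :
  skew_twist m (skew_twist n p) = skew_twist (m + n) p.
Proof. by rewrite /skew_twist iterD. Qed.

Lemma skew_twistC n c : skew_twist n c%:P = (iter n s c)%:P.
Proof.
by rewrite /skew_twist; elim: n => // n IHn; rewrite iterS IHn map_polyC.
Qed.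

Lemma coef_skew_twist n p i : (skew_twist n p)`_i = iter n s p`_i.
Proof.
by rewrite /skew_twist; elim: n => // n IHn; rewrite iterS coef_map IHn.
Qed.

Lemma skew_mulEw n p q : (size q <= n)%N ->
  skew_mul p q = \sum_(i < n) skew_twist i p * 'X^i * (q`_i)%:P.
Proof.
move=> leqn; pose F i := skew_twist i p * 'X^i * (q`_i)%:P.
rewrite /skew_mul (big_ord_widen n F) //.
rewrite [RHS](bigID (fun i : 'I_n => (i < size q)%N)) /=.
rewrite [X in _ + X]big1 ?addr0 // => i.
by rewrite -leqNgt => leqi; rewrite nth_default // mulr0.
Qed.

Lemma coef_skew_mul p q n :
  (skew_mul p q)`_n =
  \sum_(i < size q | (i <= n)%N) iter i s p`_(n - i) * q`_i.
Proof.
rewrite coef_sum [RHS]big_mkcond; apply: eq_bigr => i _.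
by rewrite coefMC coefMXn coef_skew_twist ltnNge; case: leqP; rewrite ?mul0r.
Qed.

Lemma skew_mulDr p : {morph skew_mul p : q r / q + r}.
Proof.
move=> q r; pose n := maxn (size q) (size r).
rewrite !(@skew_mulEw n) ?leq_maxl ?leq_maxr ?(leq_trans (size_polyD _ _)) //.
by rewrite -big_split; apply: eq_bigr => i _; rewrite coefD polyCD mulrDr.
Qed.

Lemma skew_mulDl : left_distributive skew_mul +%R.
Proof.
move=> p r q; rewrite /skew_mul -big_split; apply: eq_bigr => i _.
by rewrite rmorphD !mulrDl.
Qed.

Lemma skew_mulr0 p : skew_mul p 0 = 0.
Proof. by rewrite /skew_mul size_poly0 big_ord0. Qed.

Lemma skew_mul0r p : skew_mul 0 p = 0.
Proof. by rewrite /skew_mul big1 // => i _; rewrite rmorph0 !mul0r. Qed.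

Lemma skew_mulXnC p n c :
  skew_mul p ('X^n * c%:P) = skew_twist n p * 'X^n * c%:P.
Proof.
rewrite -commr_polyXn mul_polyC.
have /skew_mulEw-> : (size (c *: 'X^n) <= n.+1)%N.
  by rewrite (leq_trans (size_scale_leq _ _)) // size_polyXn.
rewrite (bigD1 ord_max) //= coefZ coefXn eqxx mulr1 big1 ?addr0 // => i.
by rewrite -val_eqE coefZ coefXn /= => /negPf->; rewrite !mulr0.
Qed.

Lemma skew_mulC p c : skew_mul p c%:P = p * c%:P.
Proof. by have := skew_mulXnC p 0 c; rewrite expr0 mul1r mulr1. Qed.

Lemma skew_mulXn p n : skew_mul p 'X^n = skew_twist n p * 'X^n.
Proof. by have := skew_mulXnC p n 1; rewrite !mulr1. Qed.

Lemma poly_monom_ind (P : {poly R} -> Prop) :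
  P 0 -> (forall p q, P p -> P q -> P (p + q)) ->
  (forall n c, P ('X^n * c%:P)) -> forall p, P p.
Proof.
move=> P0 PD Pm p; rewrite -[p]coefK poly_def; elim/big_ind: _ => // i _.
by rewrite -mul_polyC commr_polyXn.
Qed.

(** By additivity only the monomials q = Z^m c and r = Z^n d matter, and then
    both sides are s^(m+n)(p) Z^(m+n) s^n(c) d. *)
Lemma skew_mulA : associative skew_mul.
Proof.
move=> p q r; elim/poly_monom_ind: r => [|r1 r2 IH1 IH2|n d].
- by rewrite !skew_mulr0.
- by rewrite !skew_mulDr IH1 IH2.
elim/poly_monom_ind: q => [|q1 q2 IH1 IH2|m c].
- by rewrite skew_mul0r skew_mulr0 skew_mul0r.
- by rewrite skew_mulDl !skew_mulDr IH1 IH2 skew_mulDl.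
rewrite !skew_mulXnC !rmorphM /= skew_twist_twist skew_twistXn skew_twistC.
set c' := iter n s c.
have -> : 'X^m * c'%:P * 'X^n * d%:P = 'X^(m + n) * (c' * d)%:P.
  by rewrite exprD polyCM -!mulrA (mulrA c'%:P) commr_polyXn !mulrA.
rewrite skew_mulXnC [in RHS]addnC polyCM exprD -!mulrA.
by rewrite (mulrA c'%:P) commr_polyXn !mulrA.
Qed.

Lemma skew_mul1r : left_id 1 skew_mul.
Proof.
move=> p; rewrite -[RHS]coefK poly_def; apply: eq_bigr => i _.
by rewrite rmorph1 mul1r -commr_polyXn mul_polyC.
Qed.

Lemma skew_mulr1 : right_id 1 skew_mul.
Proof. by move=> p; rewrite -polyC1 skew_mulC mulr1. Qed.

HB.instance Definition _ := GRing.Zmodule_isNzRing.Build (skew_poly s)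
  skew_mulA skew_mul1r skew_mulr1 skew_mulDl skew_mulDr (oner_neq0 {poly R}).
End SkewPolynomials.

(** The leading coefficient of p q is s^m(lead p) lead q, with m the degree of
    q; it survives because s is injective. *)
Lemma skew_poly_mul_eq0 (R : idomainType) (s : {rmorphism R -> R})
    (p q : skew_poly s) :
  injective s -> p * q = 0 -> p = 0 \/ q = 0.
Proof.
move=> s_inj pq0; have [->|p0] := eqVneq (p : {poly R}) 0; first by left.
have [->|q0] := eqVneq (q : {poly R}) 0; first by right.
pose m := (size (q : {poly R})).-1.
have := coef_skew_mul s p q ((size (p : {poly R})).-1 + m).
rewrite [skew_mul _ _ _]pq0 coef0 => /esym/eqP.
have sz_q : size (q : {poly R}) = m.+1.
  by rewrite prednK // lt0n size_poly_eq0.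
have lt_q : (m < size (q : {poly R}))%N by rewrite sz_q.
rewrite (bigD1 (Ordinal lt_q)) ?leq_addl //= addnK big1 ?addr0.
  rewrite mulf_eq0 -!lead_coefE lead_coef_eq0 (negPf q0) orbF.
  rewrite (_ : iter _ s _ == 0 = (lead_coef (p : {poly R}) == 0)).
    by rewrite lead_coef_eq0 (negPf p0).
  elim: (m) => //= n <-; apply/eqP/eqP => [|->]; last exact: rmorph0.
  by rewrite -[X in _ = X](rmorph0 s) => /s_inj.
move=> i /andP[_]; rewrite -val_eqE /= => ne_i.
rewrite [X in iter _ _ X]nth_default.
  rewrite (_ : iter _ _ _ = 0) ?mul0r //.
  by elim: (i : nat) => //= n ->; rewrite rmorph0.
have lt_im : (i < m)%N.
  by rewrite ltn_neqAle ne_i -ltnS -sz_q ltn_ord.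
have : (0 < size (p : {poly R}))%N by rewrite lt0n size_poly_eq0.
case: (size _) => //= l _.
by rewrite -addnBA ?(ltnW lt_im) // -addn1 leq_add2l subn_gt0.
Qed.

(** * Matrices of size two *)

Lemma ord2_ind (P : 'I_2 -> Prop) : P 0 -> P 1 -> forall i, P i.
Proof.
move=> P0 P1 [[|[|//]] lti].
  by rewrite (_ : Ordinal lti = 0) //; apply/val_inj.
by rewrite (_ : Ordinal lti = 1) //; apply/val_inj.
Qed.

Section Mat2.
Variable S : nzRingType.
Implicit Types (M N : 'M[S]_2).

Definition mat2 (a b c d : S) : 'M[S]_2 :=
  \matrix_(i, j)
    if i == 0 then if j == 0 then a else b else if j == 0 then c else d.

Lemma mat2P M N : M 0 0 = N 0 0 -> M 0 1 = N 0 1 -> M 1 0 = N 1 0 ->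
  M 1 1 = N 1 1 -> M = N.
Proof.
by move=> M00 M01 M10 M11; apply/matrixP; apply: ord2_ind; apply: ord2_ind.
Qed.

Lemma mx2_mulE M N i j : (M * N) i j = M i 0 * N 0 j + M i 1 * N 1 j.
Proof.
rewrite mxE big_ord_recl big_ord1.
by congr (_ + M i _ * N _ j); apply/val_inj.
Qed.

Lemma mat2_mul a b c d a' b' c' d' :
  mat2 a b c d * mat2 a' b' c' d' =
  mat2 (a * a' + b * c') (a * b' + b * d') (c * a' + d * c') (c * b' + d * d').
Proof. by apply: mat2P; rewrite mx2_mulE !mxE. Qed.

Lemma mat2_add a b c d a' b' c' d' :
  mat2 a b c d + mat2 a' b' c' d' = mat2 (a + a') (b + b') (c + c') (d + d').
Proof. by apply: mat2P; rewrite !mxE. Qed.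

Lemma mat2_sub a b c d a' b' c' d' :
  mat2 a b c d - mat2 a' b' c' d' = mat2 (a - a') (b - b') (c - c') (d - d').
Proof. by apply: mat2P; rewrite !mxE. Qed.

Lemma mat2_0 : mat2 0 0 0 0 = 0.
Proof. by apply: mat2P; rewrite !mxE. Qed.

Lemma mat2_scalar a : mat2 a 0 0 a = a%:M.
Proof. by apply: mat2P; rewrite !mxE. Qed.

Lemma mat2_diag_mul a d a' d' :
  mat2 a 0 0 d * mat2 a' 0 0 d' = mat2 (a * a') 0 0 (d * d').
Proof. by rewrite mat2_mul !(mulr0, mul0r, addr0, add0r). Qed.

Definition matX : 'M[S]_2 := mat2 0 1 0 0.
Definition matY (W Z : S) : 'M[S]_2 := mat2 0 W Z 0.

Lemma matX2 : matX ^+ 2 = 0.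
Proof. by rewrite expr2 mat2_mul !(mulr0, mul0r, addr0) mat2_0. Qed.

Lemma matXY W Z : matX * matY W Z = mat2 Z 0 0 0.
Proof. by rewrite mat2_mul !(mulr0, mul0r, addr0, add0r, mul1r). Qed.

Lemma matXY_YX W Z : matX * matY W Z + matY W Z * matX = mat2 Z 0 0 Z.
Proof.
by rewrite matXY mat2_mul mat2_add !(mulr0, mul0r, addr0, add0r, mulr1).
Qed.

Lemma matY2 W Z : matY W Z ^+ 2 = mat2 (W * Z) 0 0 (Z * W).
Proof. by rewrite expr2 mat2_mul !(mulr0, mul0r, addr0, add0r). Qed.

(** The second defining relation of the super Jordan plane: only its upper right
    entry W Z - Z W - Z is not trivially zero, which is why this commutation
    relation is imposed on W and Z. *)
Lemma matXY_rel W Z : W * Z = Z * (W + 1) ->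
  let X := matX in let Y := matY W Z in
  Y * (X * Y + Y * X) - (X * Y + Y * X) * Y - X * (X * Y + Y * X) = 0.
Proof.
move=> WZ /=; rewrite matXY_YX !mat2_mul !mat2_sub.
rewrite !(mulr0, mul0r, addr0, add0r, mul1r) WZ mulrDr mulr1.
rewrite !(oppr0, subr0, subrr).
by rewrite addrAC addrK subrr addr0 mat2_0.
Qed.

Hypothesis mulS_eq0 : forall p q : S, p * q = 0 -> p = 0 \/ q = 0.

Lemma antidiag_mul_eq0 P Q M :
  mat2 0 P Q 0 * M = 0 -> M <> 0 -> P = 0 \/ Q = 0.
Proof.
move=> /matrixP E M0; have [->|/eqP P0] := eqVneq P 0; first by left.
right; have [//|/eqP Q0] := eqVneq Q 0; case: M0.
apply/matrixP => i j; rewrite mxE; elim/ord2_ind: i.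
  by have := E 1 j; rewrite mx2_mulE !mxE /= mul0r addr0 => /mulS_eq0[].
by have := E 0 j; rewrite mx2_mulE !mxE /= mul0r add0r => /mulS_eq0[].
Qed.

Lemma mul_antidiag_eq0 P Q M :
  M * mat2 0 P Q 0 = 0 -> M <> 0 -> P = 0 \/ Q = 0.
Proof.
move=> /matrixP E M0; have [->|/eqP P0] := eqVneq P 0; first by left.
right; have [//|/eqP Q0] := eqVneq Q 0; case: M0.
apply/matrixP => i j; rewrite mxE; elim/ord2_ind: j.
  by have := E i 1; rewrite mx2_mulE !mxE /= mulr0 addr0 => /mulS_eq0[].
by have := E i 0; rewrite mx2_mulE !mxE /= mulr0 add0r => /mulS_eq0[].
Qed.
End Mat2.

(** * The universal property of the super Jordan plane *)

Section UniversalProperty.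
Variables (k : fieldType) (S : nzRingType) (f : {rmorphism k -> S}) (a b : S).
Hypothesis f_central : forall c s, GRing.comm (f c) s.

Definition word_eval (m : {fmonom 'I_2}) : S :=
  \prod_(i <- (m : seq 'I_2)) (if i == 0 then a else b).

Lemma word_eval_mmorphism : mmorphism word_eval.
Proof.
by split=> [m1 m2|]; rewrite /word_eval ?fmM ?fm1 ?big_cat ?big_nil.
Qed.
HB.instance Definition _ :=
  monalg.isMultiplicative.Build _ _ word_eval word_eval_mmorphism.

Definition free_eval : free_alg k -> S := mmap f word_eval.

Lemma free_eval_zmod : zmod_morphism free_eval.
Proof. exact: mmap_is_additive. Qed.

Lemma free_eval_monoid : monoid_morphism free_eval.
Proof.
have [M1 M2] := @commr_mmap_is_multiplicative _ _ _ f word_eval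
  (fun g m m' => f_central _ _).
by split.
Qed.

HB.instance Definition _ :=
  GRing.isZmodMorphism.Build _ _ free_eval free_eval_zmod.
HB.instance Definition _ :=
  GRing.isMonoidMorphism.Build _ _ free_eval free_eval_monoid.

Lemma free_evalX : free_eval (freeX k) = a.
Proof. by rewrite /free_eval mmapU /= rmorph1 mul1r /word_eval fmU big_seq1. Qed.

Lemma free_evalY : free_eval (freeY k) = b.
Proof. by rewrite /free_eval mmapU /= rmorph1 mul1r /word_eval fmU big_seq1. Qed.

Lemma free_evalZ c g : free_eval (c *: g) = f c * free_eval g.
Proof. exact: mmapZ. Qed.

Hypothesis a2_0 : a ^+ 2 = 0.
Hypothesis rel_ab :
  b * (a * b + b * a) - (a * b + b * a) * b - a * (a * b + b * a) = 0.

Lemma free_eval_ideal g : g \in @sjp_ideal k -> free_eval g = 0.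
Proof.
move=> /sjp_idealP.
elim=> {g} [g [] -> | | g h _ eg _ eh | c g _ eg | c g _ eg].
- by apply: etrans (rmorphXn free_eval 2 (freeX k)) _; rewrite /= free_evalX.
- apply: etrans (rmorph_sjp_relE free_eval (freeX k) (freeY k)) _.
  by rewrite /= free_evalX free_evalY.
- exact: rmorph0.
- by apply: etrans (rmorphD free_eval _ _) _; rewrite /= eg eh addr0.
- by apply: etrans (rmorphM free_eval _ _) _; rewrite /= eg mulr0.
- by apply: etrans (rmorphM free_eval _ _) _; rewrite /= eg mul0r.
Qed.

(** Scalars act through a central ring morphism f instead of an algebra
    structure on S, because matrices over a noncommutative k-algebra are the
    intended target. *)
Lemma sjp_lift : exists phi : {rmorphism sjp k -> S},
  [/\ phi sjpX = a, phi sjpY = b & forall c u, phi (c *: u) = f c * phi u].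
Proof.
pose phi (u : sjp k) := free_eval (sjp_repr u).
have phiE g : phi (sjp_pi g) = free_eval g.
  apply/eqP; rewrite -subr_eq0; apply/eqP.
  apply: etrans (esym (rmorphB free_eval _ _)) _.
  by apply: free_eval_ideal; apply/sjp_piP; rewrite sjp_reprK.
have phi_zmod : zmod_morphism phi.
  move=> u v; rewrite -[u]sjp_reprK -[v]sjp_reprK -rmorphB !phiE.
  exact: rmorphB.
have phi_monoid : monoid_morphism phi.
  split=> [|u v]; first by apply: etrans (phiE 1) (rmorph1 free_eval).
  rewrite -[u]sjp_reprK -[v]sjp_reprK -rmorphM !phiE.
  exact: rmorphM.
pose phiA := GRing.isZmodMorphism.Build _ _ phi phi_zmod.
pose phiM := GRing.isMonoidMorphism.Build _ _ phi phi_monoid.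
pose Phi : {rmorphism sjp k -> S} := HB.pack phi phiA phiM.
exists Phi; split=> [||c u].
- by rewrite sjpX.unlock; apply: etrans (phiE _) free_evalX.
- by rewrite sjpY.unlock; apply: etrans (phiE _) free_evalY.
rewrite -[u]sjp_reprK -linearZ.
apply: etrans (phiE _) _; rewrite free_evalZ; congr (_ * _).
exact/esym/phiE.
Qed.
End UniversalProperty.

(** * Normal forms *)

(** These identities are stated for elements of an arbitrary ring, with z a
    variable: rewriting with the concrete z would also match its unfolding as a
    sum. *)
Section Relations.
Variables (A : nzRingType) (x y z : A).
Hypotheses (xx : x * x = 0) (zE : z = x * y + y * x).
Hypothesis yz_rel : y * z - z * y - x * z = 0.

Lemma rel_yx : y * x = z - x * y.
Proof. by rewrite zE addrC addKr. Qed.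

Lemma rel_xyx : x * y * x = z * x.
Proof. by rewrite zE mulrDl -(mulrA y) xx mulr0 addr0. Qed.

Lemma rel_xz : x * z = z * x.
Proof. by rewrite -rel_xyx zE mulrDr mulrA xx mul0r add0r mulrA. Qed.

Lemma rel_yz : y * z = z * (x + y).
Proof.
rewrite mulrDr -rel_xz; apply/eqP.
by rewrite -subr_eq0 opprD addrCA addrC -yz_rel.
Qed.

Lemma rel_tz : y ^+ 2 * z = z * (z + y ^+ 2).
Proof.
have -> : z + y ^+ 2 = (x + y) * (x + y).
  by rewrite mulrDl !mulrDr xx add0r zE addrA.
by rewrite expr2 -mulrA rel_yz mulrA rel_yz -mulrA.
Qed.

Lemma rel_xt : x * y ^+ 2 = (y ^+ 2 - z) * x.
Proof.
have xyE : x * y = z - y * x by rewrite zE addrK.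
have xzE : x * z = y * z - z * y by apply/esym/eqP; rewrite -subr_eq0 yz_rel.
rewrite expr2 mulrA xyE mulrBl -mulrA xyE mulrBr mulrA -expr2 mulrBl -rel_xz.
by rewrite xzE !opprB addrCA.
Qed.
End Relations.

Section JordanForms.
Variables (k : fieldType) (A : algType k) (z t : A).
Hypothesis tz : t * z = z * (z + t).

(** The sum of the g_j(z) t^j, where f = sum of the g_j 'X^j. *)
Definition jordan_form (f : {poly {poly k}}) : A :=
  (map_poly (horner_alg z) f).[t].

Lemma jordan_form_zmod : zmod_morphism jordan_form.
Proof. by move=> f g; rewrite /jordan_form rmorphB hornerD hornerN. Qed.
HB.instance Definition _ :=
  GRing.isZmodMorphism.Build _ _ jordan_form jordan_form_zmod.

Lemma jordan_formMX f : jordan_form (f * 'X) = jordan_form f * t.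
Proof. by rewrite /jordan_form rmorphM /= map_polyX hornerMX. Qed.

Lemma jordan_formCM c f :
  jordan_form (c%:P * f) = horner_alg z c * jordan_form f.
Proof. by rewrite /jordan_form rmorphM /= map_polyC hornerCM. Qed.

Lemma jordan_formC c : jordan_form c%:P = horner_alg z c.
Proof. by rewrite /jordan_form map_polyC hornerC. Qed.

(** The commutator with t is a derivation which sends z to z^2, hence g(z) to
    z^2 g'(z). *)
Lemma jordan_commutation (c : {poly k}) :
  t * horner_alg z c = horner_alg z c * t + horner_alg z ('X^2 * c^`()).
Proof.
elim/poly_ind: c => [|c d IH].
  by rewrite deriv0 mulr0 !rmorph0 mulr0 mul0r addr0.
have -> : 'X^2 * (c * 'X + d%:P)^`() = 'X^2 * c^`() * 'X + c * 'X * 'X.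
  rewrite derivD derivC addr0 derivM derivX mulr1 mulrDr mulrA expr2.
  by rewrite [in X in _ + X]mulrC !mulrA.
rewrite !(rmorphD, rmorphM (horner_alg z) _ 'X) /= !horner_algX horner_algC.
rewrite mulrDr mulrA IH mulrDl -(mulrA _ t) tz.
rewrite (mulrDr z) (mulrDr (horner_alg z c)) mulrDl mulr_algl mulr_algr !mulrA.
rewrite -addrA [X in X + _]addrC [X in _ + X]addrC addrACA.
by rewrite [X in _ + X = _]addrC.
Qed.

Lemma jordan_form_mulZ f : exists g, z * jordan_form f = jordan_form g.
Proof. by exists ('X%:P * f); rewrite jordan_formCM horner_algX. Qed.

Lemma jordan_form_mulT f : exists g, t * jordan_form f = jordan_form g.
Proof.
elim/poly_ind: f => [|f c [g IH]]; first by exists 0; rewrite !raddf0 mulr0.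
exists (g * 'X + (c%:P * 'X + ('X^2 * c^`())%:P)).
rewrite !raddfD /= !jordan_formMX !jordan_formC mulrDr mulrA IH.
by rewrite jordan_commutation.
Qed.

(** The forms are stable under left multiplication by the generators, hence by
    the whole subalgebra, and 1 is a form. *)
Lemma subalg_gen_jordan_form a :
  subalg_gen (fun b => b = z \/ b = t) a -> exists f, a = jordan_form f.
Proof.
move=> Ja.
suff /(_ 1)[f] : forall f, exists g, a * jordan_form f = jordan_form g.
  by rewrite -polyC1 jordan_formC rmorph1 mulr1; exists f.
elim: Ja => {a} [_ [->|->] f|f|a b _ IHa _ IHb f|a b _ IHa _ IHb f|c a _ IHa f].
- exact: jordan_form_mulZ.
- exact: jordan_form_mulT.
- by exists f; rewrite mul1r.
- have [[g ga] [h hb]] := (IHa f, IHb f).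
  by exists (g + h); rewrite raddfD mulrDl ga hb.
- by have [g gb] := IHb f; rewrite -mulrA gb; apply: IHa.
have [g ga] := IHa f; exists (c%:P%:P * g).
by rewrite jordan_formCM horner_algC -scalerAl ga mulr_algl.
Qed.
End JordanForms.

Section NormalForms.
Variable k : fieldType.
Local Notation x := (@sjpX k).
Local Notation y := (@sjpY k).
Local Notation z := (@sjpZ k).
Local Notation J := (@jordan_plane k).
Implicit Types (a b g : sjp k).

Let xx : x * x = 0. Proof. exact: sjpX2. Qed.
Let zE : z = x * y + y * x. Proof. by []. Qed.

Lemma jordan_plane0 : J 0.
Proof. by rewrite -(scale0r 1); apply/subalg_genZ/subalg_gen1. Qed.

Lemma jordan_planeN a : J a -> J (- a).
Proof. by rewrite -scaleN1r; apply: subalg_genZ. Qed.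

Lemma jordan_planeZ : J z.
Proof. by apply: subalg_gen_sub; left. Qed.

Lemma jordan_planeT : J (y ^+ 2).
Proof. by apply: subalg_gen_sub; right. Qed.

Definition normal_form g := exists u p q r,
  [/\ J u, J p, J q & J r] /\ g = u + p * x + q * y + r * (x * y).

Lemma normal_form0 : normal_form 0.
Proof.
exists 0, 0, 0, 0; split; first by split; apply: jordan_plane0.
by rewrite !mul0r !addr0.
Qed.

Lemma normal_form1 : normal_form 1.
Proof.
exists 1, 0, 0, 0; split; last by rewrite !mul0r !addr0.
by split; [apply: subalg_gen1|apply: jordan_plane0..].
Qed.

Lemma normal_formD g h : normal_form g -> normal_form h -> normal_form (g + h).
Proof.
move=> [u [p [q [r [[Ju Jp Jq Jr] ->]]]]].
move=> [u' [p' [q' [r' [[Ju' Jp' Jq' Jr'] ->]]]]].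
exists (u + u'), (p + p'), (q + q'), (r + r'); split.
  by split; apply: subalg_genD.
rewrite !mulrDl addrACA; congr (_ + _).
by rewrite addrACA; congr (_ + _); rewrite addrACA.
Qed.

Lemma normal_formZ c g : normal_form g -> normal_form (c *: g).
Proof.
move=> [u [p [q [r [[Ju Jp Jq Jr] ->]]]]].
exists (c *: u), (c *: p), (c *: q), (c *: r); split.
  by split; apply: subalg_genZ.
by rewrite !scalerDr !scalerAl.
Qed.

Lemma normal_formMx g : normal_form g -> normal_form (g * x).
Proof.
move=> [u [p [q [r [[Ju Jp Jq Jr] ->]]]]].
exists (q * z), (u + r * z), 0, (- q); split.
  split; [|apply: subalg_genD => //| |exact: jordan_planeN].
  - exact/subalg_genM/jordan_planeZ.
  - exact/subalg_genM/jordan_planeZ.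
  - exact: jordan_plane0.
rewrite [in LHS]mulrDl [in LHS]mulrDl [in LHS]mulrDl -3!mulrA.
rewrite xx mulr0 addr0 (rel_yx zE) (rel_xyx xx zE).
rewrite mul0r addr0 (mulrDl u) (mulrBr q z) mulNr (mulrA r).
by rewrite [u * x + _]addrC -!addrA; congr (_ + _); rewrite addrC addrA.
Qed.

Lemma normal_formMy g : normal_form g -> normal_form (g * y).
Proof.
move=> [u [p [q [r [[Ju Jp Jq Jr] ->]]]]].
exists (q * y ^+ 2), (r * (y ^+ 2 - z)), u, p; split.
  split=> //; first exact/subalg_genM/jordan_planeT.
  apply: subalg_genM => //; apply: subalg_genD; first exact: jordan_planeT.
  exact/jordan_planeN/jordan_planeZ.
rewrite [in LHS]mulrDl [in LHS]mulrDl [in LHS]mulrDl -4!mulrA -expr2.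
rewrite (rel_xt xx zE (sjpYZ k)) (mulrA r).
by rewrite -addrA addrC !addrA.
Qed.

Lemma normal_form_word (m : {fmonom 'I_2}) : normal_form (sjp_pi << m >>).
Proof.
have fM (m1 m2 : {fmonom 'I_2}) :
    << mmul m1 m2 >> = << m1 >> * << m2 >> :> free_alg k.
  by rewrite malgME !msuppU1 !big_seq_fset1 !mcoeffU1 !eqxx mulr1.
case: m => s; elim/last_ind: s => [|s i IHs].
  have -> : FMonom [::] = mone :> {fmonom 'I_2}.
    by apply/val_inj; rewrite /= fm1.
  by apply: eq_ind normal_form1 _ _; apply/esym/(rmorph1 (@sjp_pi k)).
have -> : FMonom (rcons s i) = mmul (FMonom s) (fmu i).
  by apply/val_inj; rewrite /= fmM fmU cats1.
rewrite fM rmorphM /=; elim/ord2_ind: i.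
  by have := normal_formMx IHs; rewrite sjpX.unlock.
by have := normal_formMy IHs; rewrite sjpY.unlock.
Qed.

(** Right multiplication by x and by y preserves normal forms, and the words in
    x and y span the algebra. *)
Lemma normal_formP g : normal_form g.
Proof.
rewrite -[g]sjp_reprK (monalgE (sjp_repr g)) raddf_sum.
elim/big_ind: _ => [||m _]; [exact: normal_form0|exact: normal_formD|].
have -> : << (sjp_repr g)@_m *g m >> =
    (sjp_repr g)@_m *: << m >> :> free_alg k.
  by apply/malgP => m'; rewrite mcoeffZ !mcoeffU mulrnAr mulr1.
by rewrite /= linearZ; apply/normal_formZ/normal_form_word.
Qed.
End NormalForms.

(** * Representations by matrices over a domain *)

Section MatrixRepresentation.
Variables (k : fieldType) (S : nzRingType) (f : {rmorphism k -> S}) (W Z : S).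
Variable phi : {rmorphism sjp k -> 'M[S]_2}.
Hypothesis f_central : forall c s, GRing.comm (f c) s.
Hypotheses (phiX : phi sjpX = matX S) (phiY : phi sjpY = matY W Z).
Hypothesis phi_scale : forall c u, phi (c *: u) = (f c)%:M * phi u.

Lemma matrix_repZ : phi sjpZ = mat2 Z 0 0 Z.
Proof. by rewrite rmorphD !rmorphM phiX phiY matXY_YX. Qed.

Lemma matrix_repT : phi (sjpY ^+ 2) = mat2 (W * Z) 0 0 (Z * W).
Proof. by rewrite rmorphXn /= phiY matY2. Qed.

(** The intertwining relation holds for z and y^2, and it is stable under the
    operations of an algebra; it makes the lower right entry vanish as soon as
    the upper left one does. *)
Lemma matrix_rep_jordan a : jordan_plane a ->
  exists p p', phi a = mat2 p 0 0 p' /\ p' * Z = Z * p.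
Proof.
elim=> {a} [a [->|->]||a b _ [p [p' [pa Ep]]] _ [q [q' [qb Eq]]]
  |a b _ [p [p' [pa Ep]]] _ [q [q' [qb Eq]]]|c a _ [p [p' [pa Ep]]]].
- by exists Z, Z; rewrite matrix_repZ.
- by exists (W * Z), (Z * W); rewrite matrix_repT mulrA.
- by exists 1, 1; rewrite rmorph1 mat2_scalar mul1r mulr1.
- exists (p + q), (p' + q'); rewrite rmorphD pa qb mat2_add !addr0.
  by rewrite mulrDl mulrDr Ep Eq.
- exists (p * q), (p' * q'); rewrite rmorphM pa qb mat2_diag_mul.
  by rewrite -mulrA Eq mulrA Ep mulrA.
exists (f c * p), (f c * p').
rewrite phi_scale pa -mat2_scalar mat2_diag_mul.
by rewrite -mulrA Ep !mulrA (f_central c Z).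
Qed.

Hypothesis mulS_eq0 : forall p q : S, p * q = 0 -> p = 0 \/ q = 0.
Hypothesis Z_neq0 : Z <> 0.
Hypothesis phi_J_inj : forall a, jordan_plane a -> phi a 0 0 = 0 -> a = 0.

Let ZpP p : Z * p = 0 -> p = 0. Proof. by case/mulS_eq0. Qed.
Let pZP p : p * Z = 0 -> p = 0. Proof. by case/mulS_eq0. Qed.

(** With subscripts for the diagonal entries on J, the image of
    u + p x + q y + r x y is (u0 + r0 Z, p0 + q0 W; q1 Z, u1), where
    q1 Z = Z q0 and u1 Z = Z u0. *)
Lemma matrix_rep_inj g : phi g = 0 -> g = 0.
Proof.
have [u [p [q [r [[Ju Jp Jq Jr] ->]]]]] := normal_formP g.
have [u0 [u1 [uE uZ]]] := matrix_rep_jordan Ju.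
have [p0 [p1 [pE _]]] := matrix_rep_jordan Jp.
have [q0 [q1 [qE qZ]]] := matrix_rep_jordan Jq.
have [r0 [r1 [rE _]]] := matrix_rep_jordan Jr.
rewrite !(rmorphD, rmorphM) /= uE pE qE rE phiX phiY matXY !mat2_mul !mat2_add.
rewrite !(mulr0, mul0r, addr0, add0r, mulr1) => /matrixP E.
have := (E 0 0, E 0 1, E 1 0, E 1 1); rewrite !mxE /= => -[[[E00 E01] E10] E11].
have q00 : q0 = 0 by apply: ZpP; rewrite -qZ.
have u00 : u0 = 0 by apply: ZpP; rewrite -uZ E11 mul0r.
have p00 : p0 = 0 by rewrite q00 mul0r addr0 in E01.
have r00 : r0 = 0 by apply: pZP; rewrite u00 add0r in E00.
have J0 a a0 a1 : jordan_plane a -> phi a = mat2 a0 0 0 a1 -> a0 = 0 -> a = 0.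
  by move=> Ja aE a00; apply: phi_J_inj => //; rewrite aE mxE.
rewrite (J0 _ _ _ Ju uE u00) (J0 _ _ _ Jp pE p00) (J0 _ _ _ Jq qE q00).
by rewrite (J0 _ _ _ Jr rE r00) !mul0r !addr0.
Qed.

Lemma matrix_rep_odd fp fm : jordan_plane fp -> jordan_plane fm ->
  exists P Q, [/\ phi (fp * sjpX + fm * sjpY) = mat2 0 P Q 0,
     Q = 0 <-> fm = 0 & P = 0 <-> fm * sjpY ^+ 2 = - (fp * sjpZ)].
Proof.
move=> Jp Jm.
have [p0 [p1 [pE _]]] := matrix_rep_jordan Jp.
have [m0 [m1 [mE mZ]]] := matrix_rep_jordan Jm.
exists (p0 + m0 * W), (m1 * Z); split.
- rewrite rmorphD !rmorphM pE mE phiX phiY !mat2_mul mat2_add.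
  by rewrite !(mulr0, mul0r, addr0, add0r, mulr1).
- split=> [|m00]; first rewrite mZ => /ZpP m00.
    by apply: phi_J_inj => //; rewrite mE mxE.
  rewrite mZ (_ : m0 = 0) ?mulr0 //.
  have := congr1 (fun M : 'M_2 => M 0 0) mE.
  by rewrite m00 rmorph0 !mxE.
(* Right multiplication by Z moves P back into the image of J, where injectivity
   is available. *)
have PZ : phi (fm * sjpY ^+ 2 + fp * sjpZ) 0 0 = (p0 + m0 * W) * Z.
  rewrite rmorphD (rmorphM _ fm) (rmorphM _ fp) pE mE matrix_repZ matrix_repT.
  by rewrite !mat2_diag_mul mat2_add mxE /= addrC mulrDl mulrA.
split=> [P0|/eqP]; last first.
  by rewrite -addr_eq0 => /eqP E; apply: pZP; rewrite -PZ E rmorph0 mxE.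
apply/eqP; rewrite -addr_eq0; apply/eqP.
apply: phi_J_inj; last by rewrite PZ P0 mul0r.
apply: subalg_genD; apply: subalg_genM => //; first exact: jordan_planeT.
exact: jordan_planeZ.
Qed.
End MatrixRepresentation.

(** * The shift algebra and the faithful representation *)

Section ShiftAlgebra.
Variable k : fieldType.

Definition shift : {rmorphism {poly k} -> {poly k}} := comp_poly ('X + 1).

(** The coefficient ring is k[W], and W Z = Z (W + 1). *)
Definition shift_alg := skew_poly shift.

Definition shZ : shift_alg := ('X : {poly {poly k}}).
Definition shW : shift_alg := ('X%:P : {poly {poly k}}).

Lemma shift_inj : injective shift.
Proof.
move=> p q /= eq_pq.
rewrite -[p](comp_polyXaddC_K _ 1) -[q](comp_polyXaddC_K _ 1).
by rewrite /shift /= -polyC1 in eq_pq; rewrite eq_pq.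
Qed.

Lemma shift_alg_mul_eq0 (p q : shift_alg) : p * q = 0 -> p = 0 \/ q = 0.
Proof. exact/skew_poly_mul_eq0/shift_inj. Qed.

Lemma shZ_neq0 : shZ <> 0.
Proof. by move/eqP; rewrite [_ == _](polyX_eq0 {poly k}). Qed.

Lemma shW_shZ_poly : shW * shZ = 'X * ('X + 1)%:P :> {poly {poly k}}.
Proof.
apply: etrans (skew_mulXn shift 'X%:P 1) _.
by rewrite /skew_twist /= map_polyC /= comp_polyX expr1 commr_polyX.
Qed.

Lemma shW_shZ : shW * shZ = shZ * (shW + 1).
Proof.
rewrite shW_shZ_poly; apply: etrans (esym (skew_mulC shift 'X ('X + 1))) _.
by rewrite polyCD polyC1.
Qed.

Lemma skew_mul_fixed p q :
  skew_twist shift 1 p = p -> skew_mul shift p q = p * q.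
Proof.
move=> p_fix; have fixn n : skew_twist shift n p = p.
  by elim: n => // n IH; rewrite -addn1 -skew_twist_twist p_fix.
rewrite -[in RHS](coefK q) poly_def mulr_sumr; apply: eq_bigr => i _.
by rewrite fixn -mul_polyC -mulrA [_%:P * _]mulrC.
Qed.

Definition shift_const (c : k) : shift_alg := (c%:P%:P : {poly {poly k}}).

Lemma shift_const_zmod : zmod_morphism shift_const.
Proof. by move=> c d; rewrite /shift_const !rmorphB. Qed.

Lemma shift_const_monoid : monoid_morphism shift_const.
Proof.
split=> // c d; rewrite /shift_const !rmorphM /=; apply/esym.
exact: skew_mulC.
Qed.

HB.instance Definition _ :=
  GRing.isZmodMorphism.Build _ _ shift_const shift_const_zmod.
HB.instance Definition _ :=
  GRing.isMonoidMorphism.Build _ _ shift_const shift_const_monoid.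

Lemma shift_const_central c p : GRing.comm (shift_const c) p.
Proof.
transitivity (c%:P%:P * (p : {poly {poly k}})).
  by apply: skew_mul_fixed; rewrite skew_twistC /= comp_polyC.
by rewrite mulrC; apply/esym; exact: skew_mulC.
Qed.

Definition shift_scalar (c : k) : 'M[shift_alg]_2 := (shift_const c)%:M.

Lemma shift_scalar_zmod : zmod_morphism shift_scalar.
Proof. by move=> c d; rewrite /shift_scalar !raddfB. Qed.

Lemma shift_scalar_monoid : monoid_morphism shift_scalar.
Proof.
by split=> [|c d]; rewrite /shift_scalar ?rmorph1 // rmorphM scalar_mxM.
Qed.

HB.instance Definition _ :=
  GRing.isZmodMorphism.Build _ _ shift_scalar shift_scalar_zmod.
HB.instance Definition _ :=
  GRing.isMonoidMorphism.Build _ _ shift_scalar shift_scalar_monoid.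

Lemma shift_scalar_central c M : GRing.comm (shift_scalar c) M.
Proof.
apply: mat2P; rewrite !mx2_mulE !mxE /= ?mulr1n ?mulr0n ?mul0r ?mulr0;
  rewrite ?addr0 ?add0r; exact: shift_const_central.
Qed.

Lemma sjp_representation : exists phi : {rmorphism sjp k -> 'M[shift_alg]_2},
  [/\ phi sjpX = matX _, phi sjpY = matY shW shZ
    & forall c u, phi (c *: u) = shift_scalar c * phi u].
Proof.
exact: sjp_lift shift_scalar_central (matX2 _) (matXY_rel shW_shZ).
Qed.
End ShiftAlgebra.

Section Faithful.
Variable k : fieldType.

(** The polynomial (W + 1) ... (W + j), for which (W Z)^j = Z^j rising j. *)
Fixpoint rising (j : nat) : {poly k} :=
  if j is j'.+1 then shift k (rising j') * ('X + 1) else 1.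

Lemma rising_monic j : rising j \is monic.
Proof.
elim: j => [|j IH] /=; first exact: monic1.
rewrite -polyC1 monicMr ?monicXaddC // monicE lead_coef_comp ?size_XaddC //.
by rewrite (monicP IH) lead_coefXaddC expr1n mulr1.
Qed.

Lemma size_rising j : size (rising j) = j.+1.
Proof.
elim: j => [|j IH] /=; first exact: size_poly1.
rewrite -polyC1 size_Mmonic ?monicXaddC //.
  by rewrite size_XaddC size_comp_poly2 ?size_XaddC // IH addn2.
by rewrite comp_poly2_eq0 ?size_XaddC // monic_neq0 ?rising_monic.
Qed.

Lemma skew_twist_map_polyC (c : {poly k}) n :
  skew_twist (shift k) n c^:P = c^:P.
Proof.
rewrite /skew_twist; elim: n => // n IH; rewrite iterS IH -map_poly_comp.
by apply: eq_map_poly => e /=; rewrite comp_polyC.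
Qed.

Variable phi : {rmorphism sjp k -> 'M[shift_alg k]_2}.
Hypotheses (phiX : phi sjpX = matX _).
Hypotheses (phiY : phi sjpY = matY (shW k) (shZ k)).
Hypothesis phi_scale : forall c u, phi (c *: u) = shift_scalar c * phi u.

Lemma shift_rep_horner (c : {poly k}) :
  phi (horner_alg sjpZ c) =
  mat2 (c^:P : shift_alg k) 0 0 (c^:P : shift_alg k).
Proof.
elim/poly_ind: c => [|c d IH]; first by rewrite !rmorph0 mat2_0.
rewrite rmorphD rmorphM /= horner_algX horner_algC rmorphD rmorphM /= IH.
rewrite (matrix_repZ phiX phiY) mat2_diag_mul phi_scale rmorph1 mulr1.
rewrite /shift_scalar -mat2_scalar mat2_add !addr0.
have -> : (c^:P : shift_alg k) * shZ k = c^:P * 'X :> {poly {poly k}}.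
  apply: etrans (skew_mulXn (shift k) c^:P 1) _.
  by rewrite skew_twist_map_polyC.
by rewrite rmorphD rmorphM /= map_polyX map_polyC.
Qed.

Lemma shift_rep_Tn j : exists q : shift_alg k,
  phi (sjpY ^+ 2) ^+ j =
  mat2 (('X^j * (rising j)%:P : {poly {poly k}}) : shift_alg k) 0 0 q.
Proof.
elim: j => [|j [q IH]].
  by exists 1; rewrite expr0 mulr1 mat2_scalar.
exists (q * (shZ k * shW k)).
rewrite exprSr IH (matrix_repT phiY) mat2_diag_mul; congr mat2.
rewrite shW_shZ_poly -['X]expr1; apply: etrans (skew_mulXnC _ _ _ _) _.
rewrite /skew_twist /= rmorphM /= map_polyXn map_polyC /= polyCM expr1.
by rewrite (exprSr _ j) !mulrA (mulrAC 'X^j).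
Qed.

Lemma shift_rep_jordan_form f :
  phi (jordan_form sjpZ (sjpY ^+ 2) f) 0 0 =
  \sum_(j < size f) (f`_j)^:P * ('X^j * (rising j)%:P) :> {poly {poly k}}.
Proof.
rewrite /jordan_form horner_poly rmorph_sum summxE; apply: eq_bigr => j _.
rewrite rmorphM rmorphXn shift_rep_horner; have [q ->] := shift_rep_Tn j.
rewrite mat2_diag_mul mxE /=; apply: etrans (skew_mulXnC _ _ _ _) _.
by rewrite skew_twist_map_polyC mulrA.
Qed.

(** Let J be the degree of f and i that of its leading coefficient. The
    coefficient of Z^(i + J) W^J in the image is the leading coefficient of
    the leading coefficient of f, because rising j has degree j < J in W for
    the other terms. *)
Lemma jordan_form_rep_inj f :
  phi (jordan_form sjpZ (sjpY ^+ 2) f) 0 0 = 0 -> f = 0.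
Proof.
move=> phi_f0; apply/eqP/negPn/negP => f0.
pose J := (size f).-1; pose i := (size (lead_coef f)).-1.
have szf : size f = J.+1 by rewrite prednK // lt0n size_poly_eq0.
have /(congr1 (fun p : {poly {poly k}} => p`_(i + J)`_J)) :=
  esym (shift_rep_jordan_form f).
rewrite phi_f0 !coef0 szf big_ord_recr /= !coefD !coef_sum big1 => [|j _].
  rewrite add0r mulrA coefMC coefMXn ltnNge leq_addl /= addnK coef_map coefCM.
  have -> : (rising J)`_J = 1.
    by have /monicP := rising_monic J; rewrite lead_coefE size_rising.
  by move/eqP; rewrite mulr1 -lead_coefE !lead_coef_eq0 (negPf f0).
rewrite mulrA coefMC coefMXn; case: ifP => _; first by rewrite mul0r coef0.
by rewrite coef_map coefCM [_`_J]nth_default ?mulr0 // size_rising.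
Qed.

Lemma jordan_rep_inj a : jordan_plane a -> phi a 0 0 = 0 -> a = 0.
Proof.
have zE : sjpZ = sjpX * sjpY + sjpY * sjpX :> sjp k by [].
have tz := rel_tz (sjpX2 k) zE (sjpYZ k).
move=> /(subalg_gen_jordan_form tz)[f ->] /jordan_form_rep_inj ->.
by rewrite raddf0.
Qed.
End Faithful.

(** * Odd zero divisors *)

Theorem proposition4p2 (k : fieldType) (hk : 2%N \notin [pchar k])
    (f1 fp fm : sjp k) (f1_odd : sjp_odd f1)
    (fp_J : jordan_plane fp) (fm_J : jordan_plane fm)
    (f1E : f1 = fp * sjpX + fm * sjpY) :
  [<-> right_zero_divisor f1;
       left_zero_divisor f1;
       nilpotent_elt f1;
       f1 ^+ 2 = 0;
       fm = 0 \/ fm * sjpY ^+ 2 = - (fp * sjpZ)].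
Proof.
have [phi [phiX phiY phi_scale]] := sjp_representation k.
have K_dom := @shift_alg_mul_eq0 k; have Z0 := @shZ_neq0 k.
have kK := @shift_const_central k.
have J_inj := jordan_rep_inj phiX phiY phi_scale.
have inj := matrix_rep_inj kK phiX phiY phi_scale K_dom Z0 J_inj.
have neq0 g : g != 0 -> phi g <> 0 by move=> /eqP g0 /inj.
have [P [Q [phi_f1 Q0 P0]]] :=
  matrix_rep_odd kK phiX phiY phi_scale K_dom Z0 J_inj fp_J fm_J.
rewrite -f1E in phi_f1.
set v := (X in [<-> _; _; _; _; X]).
have PQ_v : P = 0 \/ Q = 0 -> v by case=> [/P0|/Q0]; [right|left].
have rzd_v : right_zero_divisor f1 -> v.
  move=> [g /neq0 g0 /(congr1 phi)]; rewrite rmorphM rmorph0 phi_f1 => E.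
  exact/PQ_v/(antidiag_mul_eq0 K_dom E).
have lzd_v : left_zero_divisor f1 -> v.
  move=> [g /neq0 g0 /(congr1 phi)]; rewrite rmorphM rmorph0 phi_f1 => E.
  exact/PQ_v/(mul_antidiag_eq0 K_dom E).
have v_sq0 : v -> f1 ^+ 2 = 0.
  move=> hv; apply: inj; rewrite rmorphXn /= phi_f1 matY2.
  by case: hv => [/Q0|/P0] ->; rewrite mulr0 mul0r mat2_0.
(* The last nonzero power of f1 is annihilated by f1 on both sides. *)
have nil_zd : nilpotent_elt f1 ->
    right_zero_divisor f1 /\ left_zero_divisor f1.
  case=> n fn0.
  have [m fm0 fSm0] : exists2 m, f1 ^+ m != 0 & f1 ^+ m.+1 = 0.
    elim: n fn0 => [|n IHn] fn0.
      by have := oner_neq0 (sjp k); rewrite -fn0 expr0 eqxx.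
    by have [/IHn//|fn] := eqVneq (f1 ^+ n) 0; exists n.
  by split; exists (f1 ^+ m); rewrite -?exprS -?exprSr.
have sq0_nil : f1 ^+ 2 = 0 -> nilpotent_elt f1 by exists 2%N.
tfae.
- by move=> /rzd_v/v_sq0/sq0_nil/nil_zd[].
- by move=> /lzd_v/v_sq0/sq0_nil.
- by move=> /nil_zd[/rzd_v/v_sq0].
- by move=> /sq0_nil/nil_zd[/rzd_v].
- by move=> /v_sq0/sq0_nil/nil_zd[].
Qed.
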